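(* Let $n\ge 1$ and let $\mathcal A$ be a subalgebra of $M_n$ with $\mathcal D_n\subseteq\mathcal A\subseteq M_n$. Then $\mathcal A$ is a logmodular subalgebra of $M_n$ if and only if, after a permutation of the standard basis of $\mathbb C^n$ (that is, after conjugating $\mathcal A$ by some permutation matrix), $\mathcal A$ is an algebra of block upper triangular matrices.
   Context: $M_n$ denotes the C*-algebra of $n\times n$ complex matrices and $\mathcal D_n\subseteq M_n$ the subalgebra of diagonal matrices. For a unital C*-algebra $\mathcal B$ and a unital subalgebra $\mathcal A\subseteq\mathcal B$, $\mathcal A^{-1}$ denotes the set of elements of $\mathcal A$ that are invertible with inverse in $\mathcal A$, and $\mathcal B_+^{-1}$ denotes the set of positive invertible elements of $\mathcal B$. $\mathcal A$ is called logmodular in $\mathcal B$ if $\{a^*a : a\in\mathcal A^{-1}\}$ is (norm) dense in $\mathcal B_+^{-1}$. $\mathcal A\subseteq M_n$ is an algebra of block upper triangular matrices if there are positive integers $n_1,\ldots,n_k$ with $n=n_1+\cdots+n_k$ such that $\mathcal A$ is the set of all matrices of the form $(A_{i,j})_{i,j=1}^k$ with $A_{i,j}\in M_{n_i,n_j}$ and $A_{i,j}=0$ whenever $i>j$. *)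

(* Defs.v *)
From mathcomp Require Import all_boot all_order all_algebra all_fingroup all_field.
From mathcomp Require Import complex.
From mathcomp Require Import boolp classical_sets reals.

Set Implicit Arguments.
Unset Strict Implicit.
Unset Printing Implicit Defensive.

Import Order.TTheory GRing.Theory Num.Theory.
Local Open Scope ring_scope.
Local Open Scope sesquilinear_scope.
Local Open Scope classical_set_scope.

Definition l2norm (R : realType) n (v : 'cV[R[i]]_n) : R :=
  Num.sqrt (\sum_(k < n) ComplexField.Normc.normc (v k 0) ^+ 2).

(* The C*-norm of M_n = B(C^n); the set is nonempty (v = 0) and bounded. *)
Definition opnorm (R : realType) n (X : 'M[R[i]]_n) : R :=
  sup [set l2norm (X *m v) | v in [set v | l2norm v <= 1]].

(* Self-adjoint with spectrum in [0, +oo[ ; in the order of R[i], 0 <= l says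
   that l is real and nonnegative. *)
Definition positive_mx (R : realType) n (B : 'M[R[i]]_n) : Prop :=
  B \is hermsymmx /\ (forall l : R[i], eigenvalue B l -> 0 <= l).

Definition alg_inv (R : realType) n (A : set 'M[R[i]]_n) : set 'M[R[i]]_n :=
  [set X | [/\ A X, X \in unitmx & A (invmx X)]].

Definition pos_inv (R : realType) n : set 'M[R[i]]_n :=
  [set B | positive_mx B /\ B \in unitmx].

(* Every X^t* *m X with X invertible lies in pos_inv, so density amounts to
   approximating each element of pos_inv. *)
Definition logmodular (R : realType) n (A : set 'M[R[i]]_n) : Prop :=
  forall B, pos_inv B -> forall eps : R, 0 < eps ->
  exists2 X, alg_inv A X & opnorm (X^t* *m X - B) < eps.

(* castmx identifies n with n_1 + ... + n_k; submxblock _ i j is then the block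
   A_(i,j), of size n_i x n_j. *)
Definition block_upper_triangular_algebra (R : realType) n
    (A : set 'M[R[i]]_n) : Prop :=
  exists (k : nat) (p : 'I_k -> nat) (e : n = (\sum_(i < k) p i)%N),
    (forall i, (0 < p i)%N) /\
    A = [set X | forall i j : 'I_k, (j < i)%N ->
                   submxblock (castmx (e, e) X) i j = 0].

Definition perm_conj (R : realType) n (s : 'S_n) (A : set 'M[R[i]]_n) :
    set 'M[R[i]]_n :=
  [set perm_mx s *m X *m invmx (perm_mx s) | X in A].

(* Main.v *)
Require Import Defs.
From mathcomp Require Import all_boot all_order all_algebra all_fingroup all_field.
From mathcomp Require Import complex.
From mathcomp Require Import boolp classical_sets reals.
From mathcomp Require Import ring lra.

Set Implicit Arguments.
Unset Strict Implicit.
Unset Printing Implicit Defensive.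

Import Order.TTheory GRing.Theory Num.Theory ComplexField.Normc.
Local Open Scope ring_scope.
Local Open Scope classical_set_scope.
Local Open Scope sesquilinear_scope.

(** A subalgebra A containing the diagonal matrices is spanned by the matrix
units E_ij it contains, and [E_ij \in A] defines a reflexive and transitive
relation on the indices.  A is block upper triangular in a suitable order of
the basis exactly when this preorder is total: the blocks are then its
equivalence classes.  So the theorem says that A is logmodular if and only if
the preorder is total.

If i and j are incomparable, let S be the down-set generated by i and j; it is
the set of k with E_ki or E_kj in A.  The span of the e_k with k in S is
invariant under A, so for X invertible in A the compression of X^* X to S is
Z^* Z with Z the compression of X, and Z^-1 is the compression of X^-1.  The
(i, j) entry of (Z^* Z)^-1 = Z^-1 (Z^-1)^* is a sum over the l in S with E_il
and E_jl both in A, and no such l exists, since it would make i and j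
comparable.  Hence the inverse of the compression of X^* X always vanishes at
(i, j).  This closed condition fails for 1 + (E_ij + E_ji) / 2, which therefore
is not a limit of matrices X^* X ([logmodular_mxunit_total]).  The limit
argument is made explicit in [no_near_pair_inverse], which bounds the column j
of the inverse in the 1-norm.

Conversely, the approximation is exact.  A positive B is Q^* Q by the spectral
theorem, and Gram-Schmidt replaces Q by an upper triangular Y with the same
Q^* Q ([positive_factor], [unitary_upper_factor]).  Every block upper
triangular algebra contains Y, and it contains the inverse of Y because a
finite-dimensional algebra is closed under inverses. *)

(** * Entries and the operator norm *)

Lemma normc_ge0 (R : realType) (x : R[i]) : 0 <= normc x.
Proof. by case: x => a b; exact: sqrtr_ge0. Qed.

Lemma normc_sum (R : realType) (I : finType) (F : I -> R[i]) :
  normc (\sum_i F i) <= \sum_i normc (F i).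
Proof.
elim/big_ind2: _ => [|x a y b xa yb|//].
  by rewrite normc0.
by apply: le_trans (le_normcD _ _) _; exact: lerD.
Qed.

Lemma l2norm_delta (R : realType) n (j : 'I_n) :
  l2norm (delta_mx j 0 : 'cV[R[i]]_n) = 1.
Proof.
rewrite /l2norm (bigD1 j) //= big1 ?addr0 => [|k /negPf kj].
  by rewrite mxE !eqxx mulr1n normc1 expr1n sqrtr1.
by rewrite mxE kj mulr0n normc0 expr0n.
Qed.

Lemma normc_le_l2norm (R : realType) n (v : 'cV[R[i]]_n) k :
  normc (v k 0) <= l2norm v.
Proof.
rewrite -[leLHS]ger0_norm ?normc_ge0 // -sqrtr_sqr; apply: ler_wsqrtr.
by rewrite (bigD1 k) //= lerDl; apply: sumr_ge0 => l _; exact: sqr_ge0.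
Qed.

Lemma opnorm_has_ubound (R : realType) n (X : 'M[R[i]]_n) :
  has_ubound [set l2norm (X *m v) | v in [set v | l2norm v <= 1]].
Proof.
exists (Num.sqrt (\sum_k (\sum_l normc (X k l)) ^+ 2)) => _ [v v1 <-].
apply/ler_wsqrtr/ler_sum => k _; rewrite lerXn2r ?nnegrE ?normc_ge0 //.
  by apply: sumr_ge0 => l _; exact: normc_ge0.
rewrite mxE; apply: le_trans (normc_sum _) _; apply: ler_sum => l _.
rewrite normcM ler_piMr ?normc_ge0 //.
exact: le_trans (normc_le_l2norm _ _) v1.
Qed.

Lemma normc_entry_le_opnorm (R : realType) n (X : 'M[R[i]]_n) i j :
  normc (X i j) <= opnorm X.
Proof.
have -> : X i j = (X *m delta_mx j (0 : 'I_1)) i 0 by rewrite -colE mxE.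
apply: le_trans (normc_le_l2norm _ _) _.
apply: ub_le_sup; first exact: opnorm_has_ubound.
by exists (delta_mx j 0) => //=; rewrite l2norm_delta.
Qed.

Lemma l2norm0 (R : realType) n : l2norm (0 : 'cV[R[i]]_n) = 0.
Proof.
rewrite /l2norm big1 ?sqrtr0 // => k _.
by rewrite mxE normc0 expr0n.
Qed.

Lemma opnorm0 (R : realType) n : opnorm (0 : 'M[R[i]]_n) = 0.
Proof.
rewrite /opnorm [X in sup X](_ : _ = [set 0]) ?sup1 //.
apply/seteqP; split=> [_ [v _ <-]|_ ->] /=; first by rewrite mul0mx l2norm0.
by exists 0; rewrite /= ?mul0mx l2norm0.
Qed.

(** * The preorder of matrix units *)

Definition mxunit_rel (F : fieldType) n (A : {aspace 'M[F]_n.+1}) : rel 'I_n.+1 :=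
  fun i j => delta_mx i j \in A.

Lemma mxunit_rel_refl (F : fieldType) n (A : {aspace 'M[F]_n.+1})
    (hD : forall D : 'M[F]_n.+1, is_diag_mx D -> D \in A) :
  reflexive (mxunit_rel A).
Proof.
move=> i; apply: hD; apply/is_diag_mxP => k l kl; rewrite mxE.
by case: (eqVneq k i) kl => //= ->; case: (eqVneq l i) => [->|//]; rewrite eqxx.
Qed.

Lemma mxunit_rel_trans (F : fieldType) n (A : {aspace 'M[F]_n.+1}) :
  transitive (mxunit_rel A).
Proof.
by move=> j i k ij jk; rewrite /mxunit_rel -(mul_delta_mx j) memvM.
Qed.

(** A is the incidence algebra of its preorder: multiplying X by diagonal matrix
units on both sides isolates X i j times E_ij, so a nonzero entry of a member
of A puts the corresponding matrix unit in A. *)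
Lemma mem_mxunit_relP (F : fieldType) n (A : {aspace 'M[F]_n.+1})
    (hD : forall D : 'M[F]_n.+1, is_diag_mx D -> D \in A) (X : 'M[F]_n.+1) :
  X \in A <-> forall i j, X i j != 0 -> mxunit_rel A i j.
Proof.
split=> [XA i j Xij|supX].
  have : delta_mx i i *m X *m delta_mx j j \in A.
    by rewrite !memvM //; exact: mxunit_rel_refl.
  have -> : delta_mx i i *m X *m delta_mx j j = X i j *: delta_mx i j.
    apply/matrixP => k l; rewrite mxE (bigD1 j) //= big1 => [|m /negPf mj].
      rewrite !mxE (bigD1 i) //= big1 => [|m /negPf mi].
        rewrite !mxE !eqxx !addr0 /= ; case: (k == i); case: (l == j);
        by rewrite /= ?(mulr0, mul0r, mulr1, mul1r).
      by rewrite !mxE mi andbF mul0r.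
    by rewrite !mxE mj mulr0.
  by move/(memvZ (X i j)^-1); rewrite scalerA mulVf // scale1r.
rewrite (matrix_sum_delta X); apply: memv_suml => i _; apply: memv_suml => j _.
by have [->|/supX] := eqVneq (X i j) 0; rewrite ?scale0r ?mem0v // => /memvZ.
Qed.

(** * Logmodularity makes the preorder total *)

(** On the span of e_i and e_j this is [[1, 1/2], [1/2, 1]], whose inverse has a
nonzero off-diagonal entry; it is the identity elsewhere.  It is the positive
matrix that no X^* X approximates when i and j are incomparable. *)
Definition pair_mx (C : fieldType) n (i j : 'I_n) : 'M[C]_n :=
  1%:M + 2^-1 *: (delta_mx i j + delta_mx j i).

Lemma tr_pair_mx (C : fieldType) n (i j : 'I_n) :
  (pair_mx C i j)^T = pair_mx C i j.
Proof.
rewrite /pair_mx linearD /= trmx1 linearZ linearD /= !trmx_delta.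
by congr (_ + _ *: _); rewrite addrC.
Qed.

Lemma mul_pair_mx (C : fieldType) n (i j : 'I_n) (w : 'cV[C]_n) k :
  (pair_mx C i j *m w) k 0 =
  w k 0 + 2^-1 * ((k == i)%:R * w j 0 + (k == j)%:R * w i 0).
Proof.
rewrite /pair_mx mulmxDl mul1mx -scalemxAl mulmxDl !mxE.
have delta_w p q : \sum_l (delta_mx p q : 'M[C]_n) k l * w l 0 =
    (k == p)%:R * w q 0.
  rewrite (bigD1 q) //= big1 ?addr0 => [|l /negPf lq].
    by rewrite mxE eqxx andbT.
  by rewrite mxE lq andbF mul0r.
by rewrite !delta_w.
Qed.

(** The vector w stands for the column j of the inverse of a compression of B,
extended by zero, with a zero in position i.  Were B equal to [pair_mx], row i
of B w would be w_j / 2 and row j would be w_j, so B w could not be e_j.  For B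
close to [pair_mx] the error is controlled by the 1-norm of w, which the
equations themselves bound. *)
Lemma no_near_pair_inverse (R : realType) n (B : 'M[R[i]]_n.+1)
    (w : 'cV[R[i]]_n.+1) i j (neq_ij : i != j)
    (nearB : forall k l, normc ((B - pair_mx R[i] i j) k l) <= (8 * n.+1%:R)^-1)
    (wi : w i 0 = 0) (Bwj : (B *m w) j 0 = 1) (Bwi : (B *m w) i 0 = 0)
    (Bw : forall k, k != i -> k != j -> w k 0 = 0 \/ (B *m w) k 0 = 0) :
  False.
Proof.
(* N is the 1-norm of w and d the error vector, each entry of size at most
   N / (8 (n + 1)). *)
pose N := \sum_k normc (w k 0); pose d k := ((B - pair_mx R[i] i j) *m w) k 0.
have N0 : 0 <= N by apply: sumr_ge0 => k _; exact: normc_ge0.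
have n0 : 0 < n.+1%:R :> R by rewrite ltr0n.
have dN k : normc (d k) <= N / 8 / n.+1%:R.
  rewrite /d mxE; apply: le_trans (normc_sum _) _.
  rewrite -mulrA -invfM /N mulr_suml; apply: ler_sum => l _.
  by rewrite normcM mulrC ler_wpM2l ?normc_ge0.
have dN8 k : normc (d k) <= N / 8.
  apply: le_trans (dN k) _; rewrite ler_pdivrMr // ler_peMr ?divr_ge0 //.
  by rewrite ler1n.
have BE k : (B *m w) k 0 =
    d k + (w k 0 + 2^-1 * ((k == i)%:R * w j 0 + (k == j)%:R * w i 0)).
  by rewrite /d -{1}(subrK (pair_mx R[i] i j) B) mulmxDl mxE mul_pair_mx.
have ji : (j == i) = false by rewrite eq_sym (negPf neq_ij).
have wN k : normc (w k 0) <= (k == j)%:R + N / 8 / n.+1%:R.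
  have ge0 : 0 <= N / 8 / n.+1%:R by rewrite !divr_ge0.
  have [->|kj] := eqVneq k j.
    have -> : w j 0 = 1 - d j.
      by rewrite -Bwj BE ji eqxx wi !(mul0r, mulr0, addr0) addrC addKr.
    apply: le_trans (le_normcD _ _) _.
    by rewrite normcN normc1 lerD2l.
  rewrite add0r; have [->|ki] := eqVneq k i.
    by rewrite wi normc0.
  case: (Bw k ki kj) => [->|]; first by rewrite normc0.
  rewrite BE (negPf ki) (negPf kj) !(mul0r, mulr0, addr0).
  by move/eqP; rewrite addrC addr_eq0 => /eqP ->; rewrite normcN.
have N1 : N <= 1 + N / 8.
  apply: (@le_trans _ _ (\sum_k ((k == j)%:R + N / 8 / n.+1%:R))).
    exact: ler_sum.
  rewrite big_split /= sumr_const card_ord -[X in _ + X <= _]mulr_natr.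
  rewrite divfK ?gt_eqF // lerD2r.
  by rewrite (bigD1 j) //= eqxx big1 ?addr0 // => k /negPf ->.
have wjN : normc (w j 0) <= N / 4.
  have /eqP : d i + 2^-1 * w j 0 = 0.
    by rewrite -Bwi BE eqxx (negPf neq_ij) wi mul1r mul0r add0r addr0.
  rewrite addrC addr_eq0 => /eqP eqd.
  have -> : w j 0 = - (2 * d i).
    by rewrite -mulrN -eqd mulrA divff ?mul1r // pnatr_eq0.
  rewrite normcN normcM -[2 : R[i]]/(1 *+ 2).
  rewrite normcMn normc1; have := dN8 i; lra.
have wj1 : 1 <= normc (w j 0) + N / 8.
  rewrite -[leLHS]normc1 -Bwj BE ji eqxx wi !(mul0r, mulr0, addr0) addrC.
  by apply: le_trans (le_normcD _ _) _; rewrite lerD2l.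
(* N <= 8/7 by N1, so wjN and wj1 give 1 <= 3 N / 8 <= 3/7. *)
suff : (1 : R) <= 0 by rewrite ler10.
lra.
Qed.

(** The eigenvalues are among 1, 1/2 and 3/2. *)
Lemma eigenvalue_pair_mx (C : numClosedFieldType) n (i j : 'I_n) (l : C) :
  i != j -> eigenvalue (pair_mx C i j) l -> 0 < l.
Proof.
move=> neq_ij /eigenvalueP[v vE v0].
have ji : (j == i) = false by rewrite eq_sym (negPf neq_ij).
have E k : v 0 k + 2^-1 * ((k == i)%:R * v 0 j + (k == j)%:R * v 0 i) =
    l * v 0 k.
  have /rowP/(_ k) := vE; rewrite -[in LHS](trmxK v) -(tr_pair_mx C i j).
  by rewrite -trmx_mul [LHS]mxE mul_pair_mx !mxE.
have Ei : 2^-1 * v 0 j = (l - 1) * v 0 i.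
  by have := E i; rewrite eqxx (negPf neq_ij) mulrBl mul1r /= => <-; ring.
have Ej : 2^-1 * v 0 i = (l - 1) * v 0 j.
  by have := E j; rewrite eqxx ji mulrBl mul1r /= => <-; ring.
(* A coordinate outside {i, j} forces l = 1; the other two force
   (l - 1)^2 = 1/4. *)
have l3 : (l - 1) * (l - 2^-1) * (l - 3 / 2) = 0.
  have /rV0Pn[k vk] := v0; apply: (mulIf vk); rewrite mul0r.
  have Q p : (p == i) || (p == j) -> (l - 2^-1) * (l - 3 / 2) * v 0 p = 0.
    have -> : (l - 2^-1) * (l - 3 / 2) = (l - 1) * (l - 1) - 2^-1 * 2^-1 :> C.
      by field.
    case/orP => /eqP ->; rewrite mulrBl -!mulrA.
      by rewrite -Ei Ej; ring.
    by rewrite -Ej Ei; ring.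
  have [/Q Qk|] := boolP ((k == i) || (k == j)).
    by rewrite -!mulrA in Qk *; rewrite Qk mulr0.
  rewrite negb_or => /andP[/negPf ki /negPf kj].
  have -> : (l - 1) * (l - 2^-1) * (l - 3 / 2) * v 0 k =
      (l - 2^-1) * (l - 3 / 2) * (l * v 0 k - v 0 k) by ring.
  by rewrite -E ki kj /=; ring.
move/eqP: l3; rewrite !mulf_eq0 -orbA !subr_eq0.
by case/or3P => /eqP ->; rewrite ?ltr01 ?invr_gt0 ?divr_gt0 ?ltr0n.
Qed.

Lemma pair_mx_pos_inv (R : realType) n (i j : 'I_n) :
  i != j -> pos_inv (pair_mx R[i] i j).
Proof.
move=> neq_ij; split; last first.
  rewrite -row_free_unit -kermx_eq0; apply/negPn/negP => ker0.
  suff /(eigenvalue_pair_mx neq_ij) : eigenvalue (pair_mx R[i] i j) 0.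
    by rewrite ltxx.
  by rewrite /eigenvalue /eigenspace raddf0 subr0.
split=> [|l /(eigenvalue_pair_mx neq_ij)/ltW //].
apply/is_hermitianmxP; rewrite expr0 scale1r; apply/matrixP => k l.
rewrite !mxE rmorphD rmorphM rmorphD /= fmorphV !rmorph_nat eq_sym.
by congr (_ + _ * _); rewrite addrC; congr (_ + _); rewrite andbC.
Qed.

Lemma trmxC_mul (C : numClosedFieldType) m n p (X : 'M[C]_(m, n))
    (Y : 'M[C]_(n, p)) : (X *m Y)^t* = Y^t* *m X^t*.
Proof. by rewrite trmx_mul map_mxM. Qed.

(** With Y the inverse of X and P the projection onto S, the column j of the
inverse of the compression of X^* X to S is w = Y P Y^* e_j.  Its entry i is
the sum over l in S of Y_il conj(Y_jl), which is zero when i and j are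
incomparable. *)
Lemma logmodular_mxunit_total (R : realType) n (A : {aspace 'M[R[i]]_n.+1})
    (hD : forall D : 'M[R[i]]_n.+1, is_diag_mx D -> D \in A) :
  logmodular [set X | X \in A] -> total (mxunit_rel A).
Proof.
move=> logA i j; apply/negPn/negP; rewrite negb_or => /andP[nij nji].
have AP := mem_mxunit_relP hD; have Trefl := mxunit_rel_refl hD.
have Ttrans : transitive (mxunit_rel A) := @mxunit_rel_trans _ _ A.
have neq_ij : i != j by apply: contraNneq nij => ->.
pose S k := mxunit_rel A k i || mxunit_rel A k j.
have S_low k l : mxunit_rel A k l -> S l -> S k.
  by move=> kl /orP[] ?; apply/orP; [left|right]; apply: Ttrans kl _.
have [|X [/= XA Xu YA] XB] := logA _ (pair_mx_pos_inv R neq_ij) (8 * n.+1%:R)^-1.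
  by rewrite invr_gt0 mulr_gt0 // ltr0n.
set Y := invmx X in YA.
pose P : 'M[R[i]]_n.+1 := diag_mx (\row_k (S k)%:R).
have PE m (Z : 'M[R[i]]_(n.+1, m)) k l : (P *m Z) k l = (S k)%:R * Z k l.
  by rewrite mul_diag_mx !mxE.
(* S is a down-set, so its span is invariant under A. *)
have XP : P *m X *m P = X *m P.
  apply/matrixP => k l; rewrite -mulmxA PE mul_mx_diag !mxE.
  have [Sk|nSk] := boolP (S k); first by rewrite mul1r.
  rewrite mul0r; have [Sl|_] := boolP (S l); last by rewrite mulr0.
  have [->|/((AP X).1 XA) kl] := eqVneq (X k l) 0; first by rewrite mul0r.
  by rewrite (S_low _ _ kl Sl) in nSk.
have PH : P^t* = P.
  rewrite tr_diag_mx map_diag_mx; congr diag_mx; apply/rowP => k.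
  by rewrite !mxE rmorph_nat.
pose w := Y *m P *m (Y^t* *m delta_mx j (0 : 'I_1)).
have wE k : w k 0 = \sum_(l | S l) Y k l * (Y j l)^*.
  rewrite /w -colE mul_mx_diag mxE [RHS]big_mkcond; apply: eq_bigr => l _ /=.
  by rewrite !mxE; case: (S l); rewrite ?mulr1 // mulr0 mul0r.
have w_low k : ~~ S k -> w k 0 = 0.
  move=> nSk; rewrite wE big1 // => l Sl.
  have [->|/((AP Y).1 YA) kl] := eqVneq (Y k l) 0; first by rewrite mul0r.
  by rewrite (S_low _ _ kl Sl) in nSk.
(* P X^* X Y P Y^* e_j = P X^* P Y^* e_j = P X^* Y^* e_j = P e_j, the middle
   step by taking adjoints in XP. *)
have Bw : P *m (X^t* *m X *m w) = P *m delta_mx j (0 : 'I_1).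
  rewrite /w !mulmxA -(mulmxA _ X Y) mulmxV // mulmx1.
  have -> : P *m X^t* *m P = P *m X^t*.
    have := congr1 (fun Z => Z^t*) XP.
    by rewrite !trmxC_mul PH mulmxA.
  by rewrite -(mulmxA P) -trmxC_mul mulVmx // trmx1 map_mx1 mulmx1.
clearbody w.
have BwE k : S k -> (X^t* *m X *m w) k 0 = (k == j)%:R.
  move=> Sk; have /matrixP/(_ k 0) := Bw.
  rewrite (PE _ (X^t* *m X *m w)) (PE _ (delta_mx j 0)) Sk !mul1r => ->.
  by rewrite mxE andbT.
apply: (@no_near_pair_inverse _ _ (X^t* *m X) w i j) => //.
- by move=> k l; apply: le_trans (normc_entry_le_opnorm _ _ _) (ltW XB).
- rewrite wE big1 // => l Sl.
  have [->|/((AP Y).1 YA) il] := eqVneq (Y i l) 0; first by rewrite mul0r.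
  have [->|/((AP Y).1 YA) jl] := eqVneq (Y j l) 0; first by rewrite rmorph0 mulr0.
  by case/orP: Sl => lx; [rewrite (Ttrans _ _ _ jl lx) in nji
                         |rewrite (Ttrans _ _ _ il lx) in nij].
- by rewrite BwE ?eqxx // /S Trefl orbT.
- by rewrite BwE ?(negPf neq_ij) // /S Trefl.
move=> k ki kj; have [Sk|/w_low ->] := boolP (S k); last by left.
by right; rewrite BwE // (negPf kj).
Qed.

(** * Total preorders and block triangular form *)

(** The size of the down-set of x determines the class of x; the classes are
numbered by the position of this size among all the sizes that occur. *)
Lemma total_preorder_classes (I : finType) (T : rel I) :
  reflexive T -> transitive T -> total T ->
  exists (k : nat) (c : I -> 'I_k),
    (forall a, exists x, c x = a) /\ (forall x y, T x y = (c x <= c y)%N).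
Proof.
move=> Trefl Ttrans Ttot; pose r x := #|[pred z | T z x]|.
have TE x y : T x y = (r x <= r y)%N.
  apply/idP/idP => [xy|]; last apply: contraTT => nxy.
    by apply/subset_leq_card/fintype.subsetP => z; rewrite !inE => /Ttrans; apply.
  have yx : T y x by have := Ttot x y; rewrite (negPf nxy).
  rewrite -ltnNge; apply/proper_card/fintype.properP; split.
    by apply/fintype.subsetP => z; rewrite !inE => /Ttrans; apply.
  by exists x; rewrite !inE ?Trefl.
pose L := sort leq (undup (codom r)).
have Luniq : uniq L by rewrite sort_uniq undup_uniq.
have rL x : r x \in L by rewrite mem_sort mem_undup codom_f.
have Lsort : sorted leq L by apply: sort_sorted; exact: leq_total.
have cP x : (index (r x) L < size L)%N by rewrite index_mem.
exists (size L), (fun x => Ordinal (cP x)); split=> [a|x y] /=.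
  have : nth 0%N L a \in codom r by rewrite -mem_undup -(mem_sort leq) mem_nth.
  by case/codomP => x xa; exists x; apply: val_inj; rewrite /= -xa index_uniq.
rewrite TE; apply/idP/idP => [xy|]; last first.
  exact: (sorted_leq_index leq_trans leqnn Lsort _ _ (rL x) (rL y)).
rewrite leqNgt; apply/negP => yx.
have yx' := sorted_ltn_index leq_trans Lsort _ _ (rL y) (rL x) yx.
by rewrite (_ : r x = r y) ?ltnn // in yx; apply/eqP; rewrite eqn_leq xy.
Qed.

(** The permutation lists the class 0 first, then the class 1, and so on: an
index of the block sum is a class with a position in it, and [enum_val] turns
that position into an element of the class. *)
Lemma sort_by_classes n k (c : 'I_n -> 'I_k) (p := fun a => #|[pred i | c i == a]|) :
  exists (e : n = (\sum_(a < k) p a)%N) (s : 'S_n),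
    forall i, c (s i) = tagnat.sig1 (cast_ord e i).
Proof.
have e : n = (\sum_(a < k) p a)%N.
  rewrite -{1}(card_ord n) -sum1_card (partition_big c predT) //=.
  by apply: eq_bigr => a _; rewrite sum1_card.
pose f (x : {a : 'I_k & 'I_(p a)}) : 'I_n := enum_val (tagged x).
have cf x : c (f x) = tag x.
  by case: x => a u; rewrite /f /=; have := enum_valP u; rewrite inE => /eqP.
have f_inj : injective f.
  move=> [a u] [b v] fab; have ab : a = b by have := cf (existT _ a u); rewrite fab cf.
  by subst b; congr existT; exact: enum_val_inj fab.
exists e; have s_inj : injective (fun i => f (tagnat.sig (cast_ord e i))).
  by move=> i j /f_inj/tagnat.sig_inj/cast_ord_inj.
by exists (perm s_inj) => i; rewrite permE cf.
Qed.

Lemma block_upper_entryP (C : fieldType) n k (p : 'I_k -> nat)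
    (e : n = (\sum_(a < k) p a)%N) (X : 'M[C]_n) :
  (forall a b : 'I_k, (b < a)%N -> submxblock (castmx (e, e) X) a b = 0) <->
  (forall i j, (tagnat.sig1 (cast_ord e j) < tagnat.sig1 (cast_ord e i))%N ->
     X i j = 0).
Proof.
split=> X0 => [i j ji|a b ba].
  have /matrixP := X0 _ _ ji.
  move=> /(_ (tagnat.sig2 (cast_ord e i)) (tagnat.sig2 (cast_ord e j))).
  by rewrite !mxE castmxE !tagnat.sig2K !cast_ordK.
apply/matrixP => u v; rewrite !mxE castmxE; apply: X0.
by rewrite !cast_ordKV !tagnat.Rank1K.
Qed.

Lemma invmx_perm (C : fieldType) n (s : 'S_n) :
  invmx (perm_mx s : 'M[C]_n) = perm_mx s^-1.
Proof.
apply: (can_inj (mulKmx (unitmx_perm _ s))).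
by rewrite mulmxV ?unitmx_perm // -perm_mxM mulgV perm_mx1.
Qed.

Lemma perm_conj_entry (C : fieldType) n (s : 'S_n) (X : 'M[C]_n) i j :
  (perm_mx s *m X *m invmx (perm_mx s)) i j = X (s i) (s j).
Proof. by rewrite invmx_perm -row_permE -col_permE !mxE. Qed.

Lemma mxunit_total_block (R : realType) n (A : {aspace 'M[R[i]]_n.+1})
    (hD : forall D : 'M[R[i]]_n.+1, is_diag_mx D -> D \in A) :
  total (mxunit_rel A) ->
  exists s : 'S_n.+1,
    block_upper_triangular_algebra (perm_conj s [set X | X \in A]).
Proof.
move=> Ttot; have [k [c [c_surj cE]]] :=
  total_preorder_classes (mxunit_rel_refl hD) (@mxunit_rel_trans _ _ A) Ttot.
have [e [s cs]] := sort_by_classes c.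
exists s, k, (fun a => #|[pred i | c i == a]|), e; split.
  by move=> a; have [x <-] := c_surj a; apply/card_gt0P; exists x; rewrite inE.
apply/seteqP; split=> [_ [X /= XA <-]|Y /= /block_upper_entryP Y0].
  apply/block_upper_entryP => i j; rewrite -!cs perm_conj_entry ltnNge -cE.
  by apply: contraNeq; exact: (mem_mxunit_relP hD X).1.
pose X := \matrix_(i, j) Y (s^-1 i)%g (s^-1 j)%g.
exists X => /=; last first.
  by apply/matrixP => i j; rewrite perm_conj_entry mxE !permK.
apply/(mem_mxunit_relP hD) => i j; rewrite mxE; apply: contraNT.
by rewrite cE -ltnNge => ji; apply/eqP/Y0; rewrite -!cs !permKV.
Qed.

(** * Upper triangular factorization of positive matrices *)

Lemma positive_factor (C : numClosedFieldType) n (B : 'M[C]_n) :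
  B \is hermsymmx -> (forall l, eigenvalue B l -> 0 <= l) ->
  exists Q : 'M[C]_n, B = Q^t* *m Q.
Proof.
move=> Bh Bge0; pose P := spectralmx B; pose d := spectral_diag B.
have Pu : P \is unitarymx by exact: spectral_unitarymx.
have Punit : P \in unitmx by exact: unitarymx_unit.
have BE : B = P^t* *m diag_mx d *m P.
  by rewrite -(invmx_unitary Pu); exact/orthomx_spectralP/hermitian_normalmx.
clearbody P d.
have d0 k : 0 <= d 0 k.
  apply: Bge0; apply/eigenvalueP; exists (row k P).
    rewrite -row_mul BE !mulmxA (unitarymxP Pu) mul1mx row_mul row_diag_mx.
    by rewrite -scalemxAl -rowE.
  rewrite rowE mulmx_free_eq0 ?row_free_unit //.
  apply/eqP => /matrixP/(_ 0 k); rewrite !mxE !eqxx => /eqP.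
  by rewrite oner_eq0.
exists (diag_mx (\row_k sqrtC (d 0 k)) *m P).
rewrite trmxC_mul -mulmxA [X in P^t* *m X]mulmxA tr_diag_mx map_diag_mx mulmx_diag.
rewrite mulmxA [LHS]BE; congr (_ *m diag_mx _ *m _).
apply/rowP => k; rewrite !mxE.
by rewrite [X in _ = X * _]geC0_conj ?sqrtC_ge0 // -expr2 sqrtCK.
Qed.

(** QR factorization up to the unitary factor: Y is S Q, where S is unitary and
its rows are the Gram-Schmidt basis of the rows of Q^*.  Row j of Q^* lies in
the span of the first rows of S up to j, so it is orthogonal to row i of S for
j < i, which is Y i j = 0. *)
Lemma unitary_upper_factor (C : numClosedFieldType) n (Q : 'M[C]_n) :
  exists2 Y : 'M[C]_n, (forall i j : 'I_n, (j < i)%N -> Y i j = 0) &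
    Y^t* *m Y = Q^t* *m Q.
Proof.
pose S := schmidt (Q^t*); have Su : S \is unitarymx by exact: schmidt_unitarymx.
exists (S *m Q) => [i j ji|]; last first.
  rewrite trmxC_mul -mulmxA [S^t* *m _]mulmxA -(invmx_unitary Su).
  by rewrite mulVmx ?unitarymx_unit // mul1mx.
have : (row j (Q^t*) <= kermx ((row i S)^t*))%MS.
  apply: submx_trans (row_schmidt_sub _ _) _; apply/sumsmx_subP => k kj.
  rewrite genmxE; apply/sub_kermxP/matrixP => u v; rewrite !ord1 -dotmxE.
  rewrite (row_unitarymxP Su) mxE; case: eqP => // ki.
  by rewrite -ki ltnNge kj in ji.
move/sub_kermxP => /(congr1 (fun Z => Z^t*)); rewrite trmxC_mul !trmxCK.
rewrite trmx0 map_mx0 => /matrixP/(_ 0 0); rewrite [RHS]mxE => <-.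
by rewrite !mxE; apply: eq_bigr => l _; rewrite !mxE conjCK.
Qed.

(** * The characterization *)

(** Factoring Q s^-1 instead of Q makes the upper triangular matrix live in the
permuted basis; conjugating it back gives an element of A. *)
Lemma block_logmodular (R : realType) n (A : {aspace 'M[R[i]]_n.+1}) s :
  block_upper_triangular_algebra (perm_conj s [set X | X \in A]) ->
  logmodular [set X | X \in A].
Proof.
move=> [k [p [e [_ sAE]]]] B [Bpos Bu] eps eps0.
have [Q BE] := positive_factor Bpos.1 Bpos.2.
pose s1 : 'M[R[i]]_n.+1 := perm_mx s.
have s1u : s1 \in unitmx by exact: unitmx_perm.
have s1H : s1^t* = invmx s1 by rewrite invmx_perm tr_perm_mx map_perm_mx.
have [Y Yup YE] := unitary_upper_factor (Q *m invmx s1).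
pose X := invmx s1 *m Y *m s1.
have XE : X^t* *m X = B.
  have s1K : (invmx s1)^t* = s1 by rewrite -s1H trmxCK.
  rewrite /X !trmxC_mul s1H s1K -!mulmxA (mulmxA s1) mulmxV // mul1mx.
  rewrite (mulmxA (Y^t*)) YE trmxC_mul s1K !mulmxA mulVmx // mul1mx.
  by rewrite -(mulmxA (Q^t* *m Q)) mulVmx // mulmx1.
have XA : X \in A.
  have : perm_conj s [set X | X \in A] Y.
    rewrite sAE /=; apply/block_upper_entryP => i j; rewrite ltnNge => ji.
    (* The block number is nondecreasing, so an entry below the block diagonal is
       below the diagonal. *)
    apply: Yup; rewrite ltnNge; apply: contra ji => ij.
    by apply: (@tagnat.le_sig1 _ p (cast_ord e i) (cast_ord e j)).
  by case=> Z /= ZA ZY; rewrite /X -ZY !mulmxA mulVmx // mul1mx mulmxKV.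
have Xu : X \in unitmx by move: Bu; rewrite -XE unitmx_mul => /andP[].
exists X; last by rewrite XE subrr opnorm0.
by split=> //=; rewrite -[invmx X]/(X^-1) memvV.
Qed.

Theorem theorem2p2 (R : realType) (n : nat) (A : {aspace 'M[R[i]]_n.+1})
    (hD : forall D : 'M[R[i]]_n.+1, is_diag_mx D -> D \in A) :
  logmodular [set X | X \in A] <->
  exists s : 'S_n.+1,
    block_upper_triangular_algebra (perm_conj s [set X | X \in A]).
Proof.
split=> [/(logmodular_mxunit_total hD)|[s]]; first exact: mxunit_total_block.
exact: block_logmodular.
Qed.
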